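(* Assume $M=S^2$ and $\Sigma$ is a great circle. Then there exists a sequence $(\lambda_j,\phi_j)$ satisfying $(-\Delta_g-\lambda_j^2)\phi_j=0$, together with $\lambda_j\to+\infty$ and $$\phi_j|_\Sigma=0,\qquad \|\lambda_j^{-1}\partial_\nu\phi_j|_\Sigma\|_{L^2(\Sigma)}\le \lambda_j^{-1/4}\|\phi_j\|_{L^2(M)}.$$
   Context: $S^2$ is the unit sphere in $\mathbb{R}^3$ with its standard round metric $g$, $\Delta_g$ is the non-positive Laplace-Beltrami operator on $M=S^2$, and $\partial_\nu$ is the unit normal derivative along $\Sigma$. The space $L^2(M)$ is taken with respect to the Riemannian measure of $g$, and $L^2(\Sigma)$ with respect to the measure induced by $g$ on $\Sigma$ (arclength).
   Formalization: The printed bound with constant 1 fails for nonzero eigenfunctions vanishing on a great circle once λ_j is large; the formal statement requires φ_j nonzero and puts the constant (4/π)^{1/4}, independent of j, in front of λ_j^{-1/4}. *)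

(* Defs.v *)
From Stdlib Require Import Reals.
From Coquelicot Require Import Coquelicot.
Open Scope R_scope.

Definition R3 : Type := (R * R * R)%type.

Definition dot (p q : R3) : R :=
  let '(p1, p2, p3) := p in
  let '(q1, q2, q3) := q in
  p1 * q1 + p2 * q2 + p3 * q3.

Definition sphere (p : R3) : Prop := dot p p = 1.

Definition orthonormal (e1 e2 e3 : R3) : Prop :=
  dot e1 e1 = 1 /\ dot e2 e2 = 1 /\ dot e3 e3 = 1 /\
  dot e1 e2 = 0 /\ dot e1 e3 = 0 /\ dot e2 e3 = 0.

(** A function on S^2 is represented by some [phi : R3 -> R]; everything below
    evaluates [phi] at points of the sphere only. *)

(** ** Riemannian geometry in a local parametrization [X : R^2 -> R^3] *)

Definition Derive3 (c : R -> R3) (t : R) : R3 :=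
  (Derive (fun s => fst (fst (c s))) t,
   Derive (fun s => snd (fst (c s))) t,
   Derive (fun s => snd (c s)) t).

Definition dX1 (X : R -> R -> R3) (u v : R) : R3 := Derive3 (fun s => X s v) u.
Definition dX2 (X : R -> R -> R3) (u v : R) : R3 := Derive3 (fun s => X u s) v.

(** Coefficients of the metric induced by the Euclidean one. *)
Definition g11 X u v : R := dot (dX1 X u v) (dX1 X u v).
Definition g12 X u v : R := dot (dX1 X u v) (dX2 X u v).
Definition g22 X u v : R := dot (dX2 X u v) (dX2 X u v).
Definition gdet X u v : R := g11 X u v * g22 X u v - g12 X u v ^ 2.

(** The density of the Riemannian measure with respect to [du dv]. *)
Definition vol_density X u v : R := sqrt (gdet X u v).

(** [|g|^(-1/2) d_i (|g|^(1/2) g^(ij) d_j f)], where [f] is the expression of a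
    function in the coordinates [(u, v)], and the inverse metric is
    [g^11 = g22 / |g|], [g^12 = - g12 / |g|], [g^22 = g11 / |g|]. *)
Definition laplace_beltrami (X : R -> R -> R3) (f : R -> R -> R) (u v : R) : R :=
  let f1 := fun a b => Derive (fun s => f s b) a in
  let f2 := fun a b => Derive (fun s => f a s) b in
  let w1 := fun a b => vol_density X a b *
    (g22 X a b / gdet X a b * f1 a b - g12 X a b / gdet X a b * f2 a b) in
  let w2 := fun a b => vol_density X a b *
    (- g12 X a b / gdet X a b * f1 a b + g11 X a b / gdet X a b * f2 a b) in
  / vol_density X u v *
    (Derive (fun s => w1 s v) u + Derive (fun s => w2 u s) v).

(** ** The smooth structure of S^2 *)

(** Inverse stereographic projections from the poles [(0, 0, 1)] ([eps = 1])
    and [(0, 0, -1)] ([eps = -1]); together they are an atlas of S^2. *)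
Definition stereo (eps u v : R) : R3 :=
  let r := u ^ 2 + v ^ 2 in
  (2 * u / (1 + r), 2 * v / (1 + r), eps * ((r - 1) / (1 + r))).

Definition smooth_on_sphere (phi : R3 -> R) : Prop :=
  forall eps, eps = 1 \/ eps = -1 ->
  forall n u v, ex_diff_n (fun a b => phi (stereo eps a b)) n u v.

(** [(- Delta_g - lam^2) phi = 0] on S^2. *)
Definition helmholtz_on_sphere (lam : R) (phi : R3 -> R) : Prop :=
  forall eps, eps = 1 \/ eps = -1 ->
  forall u v,
    - laplace_beltrami (stereo eps) (fun a b => phi (stereo eps a b)) u v
    - lam ^ 2 * phi (stereo eps u v) = 0.

(** ** Great circles, traces and norms *)

(** The great circle orthogonal to the unit vector [n]. *)
Definition great_circle (n : R3) (p : R3) : Prop := sphere p /\ dot p n = 0.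

(** At a point [p] of [great_circle n], [n] is tangent to S^2 and is a unit
    normal to the circle; the derivative is taken along the geodesic issued
    from [p] with velocity [n].  The other unit normal, [- n], changes only
    the sign. *)
Definition normal_derivative (n : R3) (phi : R3 -> R) (p : R3) : R :=
  Derive (fun t => phi (plus (scal (cos t) p) (scal (sin t) n))) 0.

(** When [e1, e2, n] is orthonormal this is the parametrization of
    [great_circle n] by arclength, for [0 <= s <= 2 PI]. *)
Definition circle_param (e1 e2 : R3) (s : R) : R3 :=
  plus (scal (cos s) e1) (scal (sin s) e2).

Definition L2norm_circle (e1 e2 : R3) (f : R3 -> R) : R :=
  sqrt (RInt (fun s => f (circle_param e1 e2 s) ^ 2) 0 (2 * PI)).

(** Geodesic polar coordinates about [e3]; for an orthonormal frame they
    parametrize S^2 up to a null set, for [0 <= theta <= PI] and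
    [0 <= s <= 2 PI]. *)
Definition polar_param (e1 e2 e3 : R3) (theta s : R) : R3 :=
  plus (scal (sin theta) (circle_param e1 e2 s)) (scal (cos theta) e3).

(** The norm of L^2(S^2) for the Riemannian measure; its value is the same for
    all orthonormal frames. *)
Definition L2norm_sphere (e1 e2 e3 : R3) (f : R3 -> R) : R :=
  sqrt (RInt (fun theta => RInt (fun s =>
    f (polar_param e1 e2 e3 theta s) ^ 2
      * vol_density (polar_param e1 e2 e3) theta s) 0 (2 * PI)) 0 PI).

(** [(4 / PI)^(1/4)], about 1.0623.  For non-zero eigenfunctions vanishing on a
    great circle, the infimum over an eigenspace of
    [lam^(1/4) * |lam^(-1) d_nu phi|_L2(circle) / |phi|_L2(S^2)]
    is attained by the restriction of [z * Re ((x + i y)^(l-1))], with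
    [lam^2 = l (l + 1)]; it increases to this constant as [l] grows, and
    exceeds 1 from [l = 3] on.  Hence a bound with constant 1 fails along every
    sequence of non-zero eigenfunctions with [lam] tending to infinity. *)
Definition trace_constant : R := Rpower (4 / PI) (1 / 4).

(* Main.v *)
Require Import Defs.
From Stdlib Require Import Reals Lra Lia.
From Coquelicot Require Import Coquelicot.
Open Scope R_scope.

(** In coordinates [(x, y, z)] of the orthonormal frame, with [z] along the normal
    of the great circle, the eigenfunctions are the restrictions to the sphere of
    [z * Re ((x + i y)^k)], for [k >= 2]. Such a polynomial is harmonic and
    homogeneous of degree [k + 1], so its restriction has eigenvalue
    [lam^2 = (k + 1)(k + 2)]; it vanishes for [z = 0], and it concentrates near
    the great circle as [k] grows.

    The equation is checked in stereographic coordinates, where the metric is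
    conformal to the flat one. The flat Laplacian of a polynomial in [x, y, z] is
    determined by the Laplacians ([stereo_laplacian_coord]) and the products of
    gradients ([stereo_gradient_coord]) of the coordinates, and the latter have
    the form [h * (delta - product of the coordinates)]. Together with the chain
    rule for complex powers ([second_derivative_harmonic]) this gives
    [helmholtz_sphere_harmonic]. Smoothness holds because all expressions lie in
    a ring of functions closed under differentiation ([stereo_ring]).

    In polar coordinates about the normal the eigenfunction is
    [cos theta * sin theta ^ k * cos (k s)]. With [I_n] the integral of [sin^n]
    over [[0, PI]], the square of its norm is
    [PI * (I_(2k+1) - I_(2k+3)) = PI * I_(2k+1) / (2k + 3)], while the normal
    derivative on the circle is [cos (k s)], of squared norm [PI]. The claim is
    thus [PI^2 (2k + 3)^4 <= 16 ((k + 1)(k + 2))^3 I_(2k+1)^4]. The ratio of the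
    two sides tends to [1], so the lower bound for [I_(2k+1)] has to be
    asymptotically sharp: it comes from the Wallis product
    [I_(2k+1) I_(2k+2) = PI / (k + 1)] and the monotonicity of [I_n]
    ([sin_integral_odd_lower_bound]). *)

(** * Real and imaginary parts of powers of a complex number *)

Definition re_pow (k : nat) (x y : R) : R := Re ((x, y) ^ k)%C.
Definition im_pow (k : nat) (x y : R) : R := Im ((x, y) ^ k)%C.

(** Unfolds the abstract module operations on [R] to those that [ring] and [lra]
    recognise, keeping [INR], powers and [re_pow] folded. *)
Ltac to_reals :=
  unfold minus, plus, opp, scal, one;
  cbn -[INR re_pow im_pow pow]; unfold mult; cbn -[INR re_pow im_pow pow];
  match goal with
  | |- @eq _ ?x ?y => change (@eq R x y)
  | _ => idtac
  end.

Lemma re_pow_S k x y : re_pow (S k) x y = x * re_pow k x y - y * im_pow k x y.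
Proof. reflexivity. Qed.

Lemma im_pow_S k x y : im_pow (S k) x y = x * im_pow k x y + y * re_pow k x y.
Proof. reflexivity. Qed.

Lemma re_im_pow_scale t k x y :
  re_pow k (t * x) (t * y) = t ^ k * re_pow k x y /\
  im_pow k (t * x) (t * y) = t ^ k * im_pow k x y.
Proof.
  induction k as [|k [IHr IHi]].
  - unfold re_pow, im_pow; simpl; split; ring.
  - rewrite !re_pow_S, !im_pow_S, IHr, IHi; simpl; split; ring.
Qed.

Lemma re_pow_1_0 k : re_pow k 1 0 = 1.
Proof.
  induction k as [|k IH]; [reflexivity|].
  rewrite re_pow_S, IH; ring.
Qed.

Lemma re_im_pow_mod k x y :
  re_pow k x y ^ 2 + im_pow k x y ^ 2 = (x ^ 2 + y ^ 2) ^ k.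
Proof.
  induction k as [|k IH]; [unfold re_pow, im_pow; simpl; ring|].
  change ((x ^ 2 + y ^ 2) ^ S k) with ((x ^ 2 + y ^ 2) * (x ^ 2 + y ^ 2) ^ k).
  rewrite re_pow_S, im_pow_S, <- IH; ring.
Qed.

Lemma is_derive_Rplus (f g : R -> R) (t df dg : R) :
  is_derive f t df -> is_derive g t dg ->
  is_derive (fun s => f s + g s) t (df + dg).
Proof. intros Hf Hg; exact (is_derive_plus f g t df dg Hf Hg). Qed.

Lemma is_derive_Rminus (f g : R -> R) (t df dg : R) :
  is_derive f t df -> is_derive g t dg ->
  is_derive (fun s => f s - g s) t (df - dg).
Proof. intros Hf Hg; exact (is_derive_minus f g t df dg Hf Hg). Qed.

Lemma is_derive_Rmult (f g : R -> R) (t df dg : R) :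
  is_derive f t df -> is_derive g t dg ->
  is_derive (fun s => f s * g s) t (df * g t + f t * dg).
Proof. intros Hf Hg; exact (is_derive_mult f g t df dg Hf Hg Rmult_comm). Qed.

(** The chain rule for [(a + i b)^(k+1)], split into real and imaginary parts;
    the Cauchy-Riemann equations are what makes the two formulas alike. *)
Lemma is_derive_re_im_pow k (a b : R -> R) (t da db : R) :
  is_derive a t da -> is_derive b t db ->
  is_derive (fun s => re_pow (S k) (a s) (b s)) t
    (INR (S k) * (re_pow k (a t) (b t) * da - im_pow k (a t) (b t) * db)) /\
  is_derive (fun s => im_pow (S k) (a s) (b s)) t
    (INR (S k) * (im_pow k (a t) (b t) * da + re_pow k (a t) (b t) * db)).
Proof.
  intros Ha Hb; induction k as [|k [IHr IHi]].
  - split.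
    + apply (is_derive_ext a).
      { intros s; unfold re_pow; simpl; ring. }
      evar_last; [exact Ha|]. unfold re_pow, im_pow; to_reals; simpl; ring.
    + apply (is_derive_ext b).
      { intros s; unfold im_pow; simpl; ring. }
      evar_last; [exact Hb|]. unfold re_pow, im_pow; to_reals; simpl; ring.
  - split.
    + apply (is_derive_ext (fun s => a s * re_pow (S k) (a s) (b s)
                                    - b s * im_pow (S k) (a s) (b s))).
      { intros s; symmetry; exact (re_pow_S (S k) (a s) (b s)). }
      evar_last.
      { exact (is_derive_Rminus _ _ _ _ _ (is_derive_Rmult _ _ _ _ _ Ha IHr)
                 (is_derive_Rmult _ _ _ _ _ Hb IHi)). }
      to_reals.
      rewrite (S_INR (S k)), (re_pow_S k), (im_pow_S k); ring.
    + apply (is_derive_ext (fun s => a s * im_pow (S k) (a s) (b s)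
                                    + b s * re_pow (S k) (a s) (b s))).
      { intros s; symmetry; exact (im_pow_S (S k) (a s) (b s)). }
      evar_last.
      { exact (is_derive_Rplus _ _ _ _ _ (is_derive_Rmult _ _ _ _ _ Ha IHi)
                 (is_derive_Rmult _ _ _ _ _ Hb IHr)). }
      to_reals.
      rewrite (S_INR (S k)), (re_pow_S k), (im_pow_S k); ring.
Qed.

(** Along a coordinate line of the sphere, [a], [b], [c] will be the three
    coordinates of the moving point. Adding this identity for two orthogonal
    lines expresses the flat Laplacian of [c * re_pow (k+2) a b] through the
    Laplacians and the mutual gradient products of [a], [b], [c] alone. *)
Lemma second_derivative_harmonic k (a b c a1 b1 c1 : R -> R) (t a2 b2 c2 : R) :
  (forall s, is_derive a s (a1 s)) -> (forall s, is_derive b s (b1 s)) ->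
  (forall s, is_derive c s (c1 s)) ->
  is_derive a1 t a2 -> is_derive b1 t b2 -> is_derive c1 t c2 ->
  Derive (fun s => Derive (fun r => c r * re_pow (S (S k)) (a r) (b r)) s) t =
    c2 * re_pow (S (S k)) (a t) (b t)
     + 2 * c1 t * INR (S (S k)) *
         (re_pow (S k) (a t) (b t) * a1 t - im_pow (S k) (a t) (b t) * b1 t)
     + c t * INR (S (S k)) *
         (INR (S k) * (re_pow k (a t) (b t) * (a1 t ^ 2 - b1 t ^ 2)
                       - im_pow k (a t) (b t) * (2 * a1 t * b1 t))
          + re_pow (S k) (a t) (b t) * a2 - im_pow (S k) (a t) (b t) * b2).
Proof.
  intros Ha Hb Hc Ha1 Hb1 Hc1; apply is_derive_unique.
  apply (is_derive_ext (fun s =>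
    c1 s * re_pow (S (S k)) (a s) (b s)
    + c s * (INR (S (S k)) * (re_pow (S k) (a s) (b s) * a1 s
                              - im_pow (S k) (a s) (b s) * b1 s)))).
  { intros s; symmetry; apply is_derive_unique.
    exact (is_derive_Rmult _ _ _ _ _ (Hc s)
             (proj1 (is_derive_re_im_pow (S k) a b s _ _ (Ha s) (Hb s)))). }
  destruct (is_derive_re_im_pow (S k) a b t _ _ (Ha t) (Hb t)) as [Hr2 Hi2].
  destruct (is_derive_re_im_pow k a b t _ _ (Ha t) (Hb t)) as [Hr1 Hi1].
  evar_last.
  { exact (is_derive_Rplus _ _ _ _ _
      (is_derive_Rmult _ _ _ _ _ Hc1 Hr2)
      (is_derive_Rmult _ _ _ _ _ (Hc t)
        (is_derive_scal _ _ (INR (S (S k))) _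
          (is_derive_Rminus _ _ _ _ _ (is_derive_Rmult _ _ _ _ _ Hr1 Ha1)
            (is_derive_Rmult _ _ _ _ _ Hi1 Hb1))))). }
  to_reals; ring.
Qed.

(** * Integrals of powers of the sine, and Wallis' inequality *)

Definition sin_integral (n : nat) : R := RInt (fun x => sin x ^ n) 0 PI.

Lemma continuous_sin_pow n x : continuous (fun y => sin y ^ n) x.
Proof. apply @ex_derive_continuous; auto_derive; trivial. Qed.

Lemma is_RInt_sin_pow n : is_RInt (fun x => sin x ^ n) 0 PI (sin_integral n).
Proof.
  apply @RInt_correct, @ex_RInt_continuous; intros; apply continuous_sin_pow.
Qed.

(** The function [(n + 2) sin^(n+2) - (n + 1) sin^n] is the derivative of
    [- cos * sin^(n+1)], which vanishes at both ends of the interval. *)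
Lemma sin_integral_SS n :
  INR (n + 2) * sin_integral (n + 2) = INR (n + 1) * sin_integral n.
Proof.
  assert (H : is_RInt (fun x => INR (n + 2) * sin x ^ (n + 2)
                                - INR (n + 1) * sin x ^ n) 0 PI 0).
  { evar_last.
    { apply (is_RInt_derive (fun x => - (cos x * sin x ^ (n + 1)))).
      - intros x _. auto_derive; [trivial|].
        replace (pred (n + 1)) with n by lia.
        rewrite !pow_add, !plus_INR; to_reals. simpl.
        assert (E : sin x ^ 2 = 1 - cos x ^ 2)
          by (assert (E := sin2_cos2 x); rewrite !Rsqr_pow2 in E; lra).
        ring [E].
      - intros x _. apply @ex_derive_continuous; to_reals; auto_derive; trivial. }
    rewrite sin_PI, sin_0, pow_i by lia. to_reals; ring. }
  assert (H' := is_RInt_minus _ _ _ _ _ _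
    (is_RInt_scal _ _ _ (INR (n + 2)) _ (is_RInt_sin_pow (n + 2)))
    (is_RInt_scal _ _ _ (INR (n + 1)) _ (is_RInt_sin_pow n))).
  apply Rminus_diag_uniq.
  rewrite <- (is_RInt_unique _ _ _ _ H); symmetry.
  exact (is_RInt_unique _ _ _ _ H').
Qed.

Lemma sin_integral_pos n : 0 < sin_integral n.
Proof.
  apply RInt_gt_0; [apply PI_RGT_0| |].
  - intros x Hx; apply pow_lt, sin_gt_0; apply Hx.
  - intros x _; apply continuous_sin_pow.
Qed.

Lemma sin_integral_0_1 : sin_integral 0 = PI /\ sin_integral 1 = 2.
Proof.
  split; apply is_RInt_unique.
  - evar_last; [apply (is_RInt_derive (fun x => x))|].
    + intros x _; auto_derive; simpl; auto.
    + intros; apply continuous_sin_pow.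
    + to_reals; ring.
  - evar_last; [apply (is_RInt_derive (fun x => - cos x))|].
    + intros x _; auto_derive; simpl; [trivial|ring].
    + intros; apply continuous_sin_pow.
    + rewrite cos_PI, cos_0; to_reals; ring.
Qed.

(** By [sin_integral_SS] the left side does not depend on [n]. *)
Lemma sin_integral_consecutive n :
  INR (S n) * (sin_integral n * sin_integral (S n)) = 2 * PI.
Proof.
  induction n as [|n IH].
  - destruct sin_integral_0_1 as [-> ->]; simpl; ring.
  - rewrite <- IH. assert (E := sin_integral_SS n).
    replace (n + 2)%nat with (S (S n)) in E by lia.
    replace (n + 1)%nat with (S n) in E by lia.
    rewrite <- Rmult_assoc, (Rmult_comm _ (sin_integral (S n))), Rmult_assoc.
    rewrite E. ring.
Qed.

Lemma sin_integral_decreasing n : sin_integral (S n) <= sin_integral n.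
Proof.
  apply RInt_le; [left; apply PI_RGT_0| | |].
  - eexists; apply is_RInt_sin_pow.
  - eexists; apply is_RInt_sin_pow.
  - intros x Hx.
    assert (P : 0 <= sin x ^ n) by (apply pow_le; left; apply sin_gt_0; apply Hx).
    assert (B := SIN_bound x); simpl; nra.
Qed.

(** Write [I_n] for [sin_integral n] and [x] for [INR k]. Since [I_n] decreases,
    [I_(2k+1)^2 >= I_(2k+1) I_(2k+2) = PI / (x + 1)], and the claim is reduced to
    [(2x + 3)^4 <= 16 (x + 1)(x + 2)^3]. The two sides agree to leading order;
    the next coefficients are [96] and [112]. *)
Lemma sin_integral_odd_lower_bound k :
  PI ^ 2 * (2 * INR k + 3) ^ 4
  <= 16 * ((INR k + 1) * (INR k + 2)) ^ 3 * sin_integral (2 * k + 1) ^ 4.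
Proof.
  assert (W := sin_integral_consecutive (2 * k + 1)).
  assert (D := sin_integral_decreasing (2 * k + 1)).
  assert (P1 := sin_integral_pos (2 * k + 1)).
  assert (P2 := sin_integral_pos (S (2 * k + 1))).
  rewrite S_INR, plus_INR, mult_INR in W.
  change (INR 2) with 2 in W; change (INR 1) with 1 in W.
  set (I1 := sin_integral (2 * k + 1)) in *.
  set (I2 := sin_integral (S (2 * k + 1))) in *.
  assert (Hk := pos_INR k); set (x := INR k) in *.
  assert (EP : PI = (x + 1) * (I1 * I2)) by lra.
  rewrite EP.
  apply Rle_trans with (((x + 1) * (I1 * I1)) ^ 2 * (2 * x + 3) ^ 4).
  - apply Rmult_le_compat_r; [apply pow_le; lra|].
    apply pow_incr; split; [|apply Rmult_le_compat_l; [lra|]].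
    + repeat apply Rmult_le_pos; lra.
    + apply Rmult_le_compat_l; lra.
  - assert (Q : (2 * x + 3) ^ 4 <= 16 * ((x + 1) * (x + 2) ^ 3)).
    { assert (0 <= x ^ 2) by (apply pow_le; exact Hk).
      assert (0 <= x ^ 3) by (apply pow_le; exact Hk).
      apply Rminus_le; ring_simplify; lra. }
    replace (16 * ((x + 1) * (x + 2)) ^ 3 * I1 ^ 4)
      with (((x + 1) * (I1 * I1)) ^ 2 * (16 * ((x + 1) * (x + 2) ^ 3))) by ring.
    apply Rmult_le_compat_l; [apply pow2_ge_0|exact Q].
Qed.

(** With [r = cos ((k+1) s)] and [i = sin ((k+1) s)] the integrand is [r^2], and
    [(s + r i / (k+1)) / 2] is a primitive of it because [r^2 + i^2 = 1]. The
    endpoint terms cancel by periodicity. *)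
Lemma is_RInt_re_pow_circle k :
  is_RInt (fun s => re_pow (S k) (cos s) (sin s) ^ 2) 0 (2 * PI) PI.
Proof.
  assert (Dr : forall s, is_derive (fun s => re_pow (S k) (cos s) (sin s)) s
                (- INR (S k) * im_pow (S k) (cos s) (sin s))).
  { intros s. evar_last.
    - exact (proj1 (is_derive_re_im_pow k cos sin s _ _ (is_derive_cos s)
                                                (is_derive_sin s))).
    - rewrite im_pow_S. ring. }
  assert (Di : forall s, is_derive (fun s => im_pow (S k) (cos s) (sin s)) s
                (INR (S k) * re_pow (S k) (cos s) (sin s))).
  { intros s. evar_last.
    - exact (proj2 (is_derive_re_im_pow k cos sin s _ _ (is_derive_cos s)
                                                (is_derive_sin s))).
    - rewrite re_pow_S. ring. }
  assert (NZ : INR (S k) <> 0) by (apply not_0_INR; lia).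
  evar_last.
  { apply (is_RInt_derive (fun s => / 2 * (s + / INR (S k) *
      (re_pow (S k) (cos s) (sin s) * im_pow (S k) (cos s) (sin s))))).
    - intros s _. evar_last.
      { exact (is_derive_scal _ s (/ 2) _
          (is_derive_Rplus _ _ s _ _ (is_derive_id s)
            (is_derive_scal _ s (/ INR (S k)) _
              (is_derive_Rmult _ _ s _ _ (Dr s) (Di s))))). }
      assert (M := re_im_pow_mod (S k) (cos s) (sin s)).
      assert (T := sin2_cos2 s); rewrite !Rsqr_pow2, Rplus_comm in T.
      rewrite T, pow1 in M.
      to_reals.
      set (r := re_pow (S k) (cos s) (sin s)) in *.
      set (i := im_pow (S k) (cos s) (sin s)) in *.
      replace (/ 2 * (1 + / INR (S k) * (- INR (S k) * i * i + r * (INR (S k) * r))))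
        with (/ 2 * (1 + (r ^ 2 - i ^ 2))) by (field; exact NZ).
      simpl in M |- *; lra.
    - intros s _. apply @ex_derive_continuous.
      eexists; exact (is_derive_pow _ 2 s _ (Dr s)). }
  rewrite cos_2PI, sin_2PI, cos_0, sin_0; to_reals; field; exact NZ.
Qed.

(** * Smoothness in the stereographic charts *)

(** The restriction to the sphere of the harmonic polynomial
    [z * Re ((x + i y)^k)], in the frame [(e1, e2, e3)]. *)
Definition sphere_harmonic (e1 e2 e3 : R3) (k : nat) (p : R3) : R :=
  dot p e3 * re_pow k (dot p e1) (dot p e2).

(** Up to pointwise equality, the ring generated by the two chart coordinates and
    [1 / (1 + u^2 + v^2)]. It contains the expression of every polynomial on the
    sphere and is closed under both partial derivatives, so that its elements
    are smooth without any computation of higher derivatives. *)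
Inductive stereo_ring : (R -> R -> R) -> Prop :=
| stereo_ring_const c : stereo_ring (fun _ _ => c)
| stereo_ring_fst : stereo_ring (fun u _ => u)
| stereo_ring_snd : stereo_ring (fun _ v => v)
| stereo_ring_inv : stereo_ring (fun u v => / (1 + (u ^ 2 + v ^ 2)))
| stereo_ring_plus f g :
    stereo_ring f -> stereo_ring g -> stereo_ring (fun u v => f u v + g u v)
| stereo_ring_mult f g :
    stereo_ring f -> stereo_ring g -> stereo_ring (fun u v => f u v * g u v)
| stereo_ring_ext f g :
    (forall u v, f u v = g u v) -> stereo_ring f -> stereo_ring g.

Lemma stereo_denominator_pos u v : 0 < 1 + (u ^ 2 + v ^ 2).
Proof. nra. Qed.

Lemma stereo_ring_continuous f u v : stereo_ring f -> continuity_2d_pt f u v.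
Proof.
  induction 1 as [c| | | |f g _ IHf _ IHg|f g _ IHf _ IHg|f g E _ IHf].
  - apply continuity_2d_pt_const.
  - apply continuity_2d_pt_id1.
  - apply continuity_2d_pt_id2.
  - apply continuity_2d_pt_inv; [|apply Rgt_not_eq, stereo_denominator_pos].
    apply continuity_2d_pt_plus; [apply continuity_2d_pt_const|].
    apply (continuity_2d_pt_ext (fun a b => a * a + b * b)); [intros; ring|].
    apply continuity_2d_pt_plus; apply continuity_2d_pt_mult;
      first [apply continuity_2d_pt_id1|apply continuity_2d_pt_id2].
  - now apply continuity_2d_pt_plus.
  - now apply continuity_2d_pt_mult.
  - exact (continuity_2d_pt_ext f g u v E IHf).
Qed.

Lemma stereo_ring_derive f :
  stereo_ring f ->
  (exists g, stereo_ring g /\ forall u v, is_derive (fun s => f s v) u (g u v)) /\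
  (exists g, stereo_ring g /\ forall u v, is_derive (fun s => f u s) v (g u v)).
Proof.
  assert (Sq : stereo_ring (fun u v => / (1 + (u ^ 2 + v ^ 2)) * / (1 + (u ^ 2 + v ^ 2))))
    by (apply stereo_ring_mult; apply stereo_ring_inv).
  induction 1 as
    [c| | | |f g Hf [[f1 [Sf1 Df1]] [f2 [Sf2 Df2]]] Hg [[g1 [Sg1 Dg1]] [g2 [Sg2 Dg2]]]
    |f g Hf [[f1 [Sf1 Df1]] [f2 [Sf2 Df2]]] Hg [[g1 [Sg1 Dg1]] [g2 [Sg2 Dg2]]]
    |f g E _ [[f1 [Sf1 Df1]] [f2 [Sf2 Df2]]]].
  - split; exists (fun _ _ => 0); (split; [constructor|]); intros; apply @is_derive_const.
  - split; [exists (fun _ _ => 1)|exists (fun _ _ => 0)]; (split; [constructor|]); intros.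
    + apply @is_derive_id.
    + apply @is_derive_const.
  - split; [exists (fun _ _ => 0)|exists (fun _ _ => 1)]; (split; [constructor|]); intros.
    + apply @is_derive_const.
    + apply @is_derive_id.
  - split;
      [exists (fun u v => -2 * u * (/ (1 + (u ^ 2 + v ^ 2)) * / (1 + (u ^ 2 + v ^ 2))))
      |exists (fun u v => -2 * v * (/ (1 + (u ^ 2 + v ^ 2)) * / (1 + (u ^ 2 + v ^ 2))))];
      (split;
       [first [exact (stereo_ring_mult _ _ (stereo_ring_mult _ _ (stereo_ring_const (-2))
                        stereo_ring_fst) Sq)
              |exact (stereo_ring_mult _ _ (stereo_ring_mult _ _ (stereo_ring_const (-2))
                        stereo_ring_snd) Sq)]|]);
      intros u v; assert (P := stereo_denominator_pos u v);
      (auto_derive; [lra|field; lra]).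
  - split; [exists (fun u v => f1 u v + g1 u v)|exists (fun u v => f2 u v + g2 u v)];
      (split; [now apply stereo_ring_plus|]); intros u v.
    + exact (is_derive_Rplus _ _ _ _ _ (Df1 u v) (Dg1 u v)).
    + exact (is_derive_Rplus _ _ _ _ _ (Df2 u v) (Dg2 u v)).
  - split; [exists (fun u v => f1 u v * g u v + f u v * g1 u v)
           |exists (fun u v => f2 u v * g u v + f u v * g2 u v)];
      (split; [apply stereo_ring_plus; now apply stereo_ring_mult|]); intros u v.
    + exact (is_derive_Rmult _ _ _ _ _ (Df1 u v) (Dg1 u v)).
    + exact (is_derive_Rmult _ _ _ _ _ (Df2 u v) (Dg2 u v)).
  - split; [exists f1|exists f2]; (split; [assumption|]); intros u v.
    + exact (is_derive_ext _ _ u _ (fun s => E s v) (Df1 u v)).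
    + exact (is_derive_ext _ _ v _ (fun s => E u s) (Df2 u v)).
Qed.

Lemma stereo_ring_smooth f n u v : stereo_ring f -> ex_diff_n f n u v.
Proof.
  revert f; induction n as [|n IH]; intros f Hf; simpl.
  - split; [now apply stereo_ring_continuous|trivial].
  - destruct (stereo_ring_derive f Hf) as [[f1 [S1 D1]] [f2 [S2 D2]]].
    split; [now apply stereo_ring_continuous|].
    split; [eexists; apply D1|]. split; [eexists; apply D2|]. split.
    + apply (ex_diff_n_ext_loc f1); [|now apply IH].
      apply locally_2d_forall; intros a b; symmetry; apply is_derive_unique, D1.
    + apply (ex_diff_n_ext_loc f2); [|now apply IH].
      apply locally_2d_forall; intros a b; symmetry; apply is_derive_unique, D2.
Qed.

Lemma stereo_ring_dot eps e : stereo_ring (fun u v => dot (stereo eps u v) e).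
Proof.
  destruct e as [[x y] z].
  apply (stereo_ring_ext (fun u v => (2 * x * u + 2 * y * v) * / (1 + (u ^ 2 + v ^ 2))
    + eps * z * (1 + -2 * / (1 + (u ^ 2 + v ^ 2))))).
  - intros u v; assert (P := stereo_denominator_pos u v).
    unfold dot, stereo; field; lra.
  - exact (stereo_ring_plus _ _
      (stereo_ring_mult _ _
        (stereo_ring_plus _ _
          (stereo_ring_mult _ _ (stereo_ring_const (2 * x)) stereo_ring_fst)
          (stereo_ring_mult _ _ (stereo_ring_const (2 * y)) stereo_ring_snd))
        stereo_ring_inv)
      (stereo_ring_mult _ _ (stereo_ring_const (eps * z))
        (stereo_ring_plus _ _ (stereo_ring_const 1)
          (stereo_ring_mult _ _ (stereo_ring_const (-2)) stereo_ring_inv)))).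
Qed.

Lemma stereo_ring_re_im_pow k f g :
  stereo_ring f -> stereo_ring g ->
  stereo_ring (fun u v => re_pow k (f u v) (g u v)) /\
  stereo_ring (fun u v => im_pow k (f u v) (g u v)).
Proof.
  intros Hf Hg; induction k as [|k [IHr IHi]].
  - split; [exact (stereo_ring_const 1)|exact (stereo_ring_const 0)].
  - split.
    + apply (stereo_ring_ext (fun u v => f u v * re_pow k (f u v) (g u v)
               + -1 * (g u v * im_pow k (f u v) (g u v)))).
      * intros u v; rewrite re_pow_S; ring.
      * exact (stereo_ring_plus _ _ (stereo_ring_mult _ _ Hf IHr)
          (stereo_ring_mult _ _ (stereo_ring_const (-1)) (stereo_ring_mult _ _ Hg IHi))).
    + apply (stereo_ring_ext (fun u v => f u v * im_pow k (f u v) (g u v)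
               + g u v * re_pow k (f u v) (g u v))).
      * intros u v; now rewrite im_pow_S.
      * exact (stereo_ring_plus _ _ (stereo_ring_mult _ _ Hf IHi)
                                    (stereo_ring_mult _ _ Hg IHr)).
Qed.

Lemma smooth_sphere_harmonic e1 e2 e3 k :
  smooth_on_sphere (sphere_harmonic e1 e2 e3 k).
Proof.
  intros eps _ n u v; apply stereo_ring_smooth.
  exact (stereo_ring_mult _ _ (stereo_ring_dot eps e3)
    (proj1 (stereo_ring_re_im_pow k _ _ (stereo_ring_dot eps e1) (stereo_ring_dot eps e2)))).
Qed.

(** * The eigenvalue equation *)

Definition stereo_u (eps u v : R) : R3 :=
  let d := 1 + (u ^ 2 + v ^ 2) in
  (2 * (1 - u ^ 2 + v ^ 2) / d ^ 2, - 4 * u * v / d ^ 2, 4 * eps * u / d ^ 2).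

Definition stereo_v (eps u v : R) : R3 :=
  let d := 1 + (u ^ 2 + v ^ 2) in
  (- 4 * u * v / d ^ 2, 2 * (1 + u ^ 2 - v ^ 2) / d ^ 2, 4 * eps * v / d ^ 2).

Definition stereo_uu (eps u v : R) : R3 :=
  let d := 1 + (u ^ 2 + v ^ 2) in
  (4 * u * (u ^ 2 - 3 * v ^ 2 - 3) / d ^ 3, 4 * v * (3 * u ^ 2 - v ^ 2 - 1) / d ^ 3,
   4 * eps * (1 - 3 * u ^ 2 + v ^ 2) / d ^ 3).

Definition stereo_vv (eps u v : R) : R3 :=
  let d := 1 + (u ^ 2 + v ^ 2) in
  (4 * u * (3 * v ^ 2 - u ^ 2 - 1) / d ^ 3, 4 * v * (v ^ 2 - 3 * u ^ 2 - 3) / d ^ 3,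
   4 * eps * (1 - 3 * v ^ 2 + u ^ 2) / d ^ 3).

Ltac stereo_calculus e u v :=
  destruct e as [[x y] z]; assert (P := stereo_denominator_pos u v);
  unfold dot, stereo, stereo_u, stereo_v, stereo_uu, stereo_vv; cbn -[pow];
  auto_derive;
  [repeat split; repeat apply Rmult_integral_contrapositive_currified;
   simpl in P |- *; lra
  |field; lra].

Lemma is_derive_stereo_u eps e u v :
  is_derive (fun s => dot (stereo eps s v) e) u (dot (stereo_u eps u v) e).
Proof. stereo_calculus e u v. Qed.

Lemma is_derive_stereo_v eps e u v :
  is_derive (fun s => dot (stereo eps u s) e) v (dot (stereo_v eps u v) e).
Proof. stereo_calculus e u v. Qed.

Lemma is_derive_stereo_uu eps e u v :
  is_derive (fun s => dot (stereo_u eps s v) e) u (dot (stereo_uu eps u v) e).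
Proof. stereo_calculus e u v. Qed.

Lemma is_derive_stereo_vv eps e u v :
  is_derive (fun s => dot (stereo_v eps u s) e) v (dot (stereo_vv eps u v) e).
Proof. stereo_calculus e u v. Qed.

(** The factor [h] for which the round metric reads [h (du^2 + dv^2)]. *)
Definition conformal_factor (u v : R) : R := 4 / (1 + (u ^ 2 + v ^ 2)) ^ 2.

(** In two dimensions the Laplacian is conformally covariant, so that this is the
    statement that linear functions have eigenvalue [-2] on the sphere. *)
Lemma stereo_laplacian_coord eps e u v :
  dot (stereo_uu eps u v) e + dot (stereo_vv eps u v) e
  = - 2 * conformal_factor u v * dot (stereo eps u v) e.
Proof.
  destruct e as [[x y] z]; assert (P := stereo_denominator_pos u v).
  unfold dot, stereo, stereo_uu, stereo_vv, conformal_factor; cbn -[pow]; field; lra.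
Qed.

(** The gradient on the sphere of [p |-> dot p e] is the tangential part
    [e - (dot p e) p] of [e]; the right side is the product of two of them,
    and the factor passes from the round to the flat metric. *)
Lemma stereo_gradient_coord eps e f u v :
  eps = 1 \/ eps = -1 ->
  dot (stereo_u eps u v) e * dot (stereo_u eps u v) f
  + dot (stereo_v eps u v) e * dot (stereo_v eps u v) f
  = conformal_factor u v *
    (dot e f - dot (stereo eps u v) e * dot (stereo eps u v) f).
Proof.
  destruct e as [[x y] z]; destruct f as [[x' y'] z'].
  assert (P := stereo_denominator_pos u v).
  unfold dot, stereo, stereo_u, stereo_v, conformal_factor; cbn -[pow].
  intros [-> | ->]; field; lra.
Qed.

Lemma stereo_metric eps u v :
  eps = 1 \/ eps = -1 ->
  g11 (stereo eps) u v = conformal_factor u v /\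
  g12 (stereo eps) u v = 0 /\
  g22 (stereo eps) u v = conformal_factor u v.
Proof.
  intros Heps; assert (P := stereo_denominator_pos u v).
  assert (E1 : dX1 (stereo eps) u v = stereo_u eps u v).
  { unfold dX1, Derive3, stereo; cbn -[pow].
    unfold stereo_u; repeat f_equal; apply is_derive_unique;
    (auto_derive; [simpl in P |- *; lra|field; lra]). }
  assert (E2 : dX2 (stereo eps) u v = stereo_v eps u v).
  { unfold dX2, Derive3, stereo; cbn -[pow].
    unfold stereo_v; repeat f_equal; apply is_derive_unique;
    (auto_derive; [simpl in P |- *; lra|field; lra]). }
  unfold g11, g12, g22; rewrite E1, E2.
  unfold dot, stereo_u, stereo_v, conformal_factor; cbn -[pow].
  destruct Heps as [-> | ->]; repeat split; field; lra.
Qed.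

Lemma conformal_factor_pos u v : 0 < conformal_factor u v.
Proof.
  assert (P := stereo_denominator_pos u v).
  apply Rdiv_lt_0_compat; [lra|now apply pow_lt].
Qed.

(** For a metric [h (du^2 + dv^2)] the density cancels the inverse metric, which
    leaves the flat Laplacian divided by [h]. *)
Lemma laplace_beltrami_stereo eps f u v :
  eps = 1 \/ eps = -1 ->
  laplace_beltrami (stereo eps) f u v =
  / conformal_factor u v *
  (Derive (fun s => Derive (fun t => f t v) s) u
   + Derive (fun s => Derive (fun t => f u t) s) v).
Proof.
  intros Heps.
  assert (G : forall a b, gdet (stereo eps) a b = conformal_factor a b ^ 2).
  { intros a b; unfold gdet; destruct (stereo_metric eps a b Heps) as [-> [-> ->]]; ring. }
  assert (V : forall a b, vol_density (stereo eps) a b = conformal_factor a b).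
  { intros a b; unfold vol_density; rewrite G.
    apply sqrt_pow2, Rlt_le, conformal_factor_pos. }
  unfold laplace_beltrami; rewrite V; f_equal; f_equal; apply Derive_ext; intros s;
  [destruct (stereo_metric eps s v Heps) as [E1 [E2 E3]];
   assert (P := conformal_factor_pos s v)
  |destruct (stereo_metric eps u s Heps) as [E1 [E2 E3]];
   assert (P := conformal_factor_pos u s)];
  rewrite V, G, ?E1, E2, ?E3; field; lra.
Qed.

(** With [n = k + 2] the degree of the power, the terms of the Laplacian of
    [c * re_pow n a b] contribute [-2], [-2n], [-n(n-1)] and [-2n], which add
    up to [-(n+1)(n+2)]. *)
Lemma helmholtz_sphere_harmonic e1 e2 e3 k lam :
  orthonormal e1 e2 e3 -> lam ^ 2 = (INR k + 3) * (INR k + 4) ->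
  helmholtz_on_sphere lam (sphere_harmonic e1 e2 e3 (S (S k))).
Proof.
  intros (N1 & N2 & N3 & N12 & N13 & N23) Hlam eps Heps u v.
  rewrite laplace_beltrami_stereo by exact Heps.
  assert (Pos := conformal_factor_pos u v).
  unfold sphere_harmonic; cbv beta.
  rewrite (second_derivative_harmonic k
    (fun t => dot (stereo eps t v) e1) (fun t => dot (stereo eps t v) e2)
    (fun t => dot (stereo eps t v) e3) (fun t => dot (stereo_u eps t v) e1)
    (fun t => dot (stereo_u eps t v) e2) (fun t => dot (stereo_u eps t v) e3)
    u _ _ _ (fun s => is_derive_stereo_u eps e1 s v)
    (fun s => is_derive_stereo_u eps e2 s v) (fun s => is_derive_stereo_u eps e3 s v)
    (is_derive_stereo_uu eps e1 u v) (is_derive_stereo_uu eps e2 u v)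
    (is_derive_stereo_uu eps e3 u v)).
  rewrite (second_derivative_harmonic k
    (fun t => dot (stereo eps u t) e1) (fun t => dot (stereo eps u t) e2)
    (fun t => dot (stereo eps u t) e3) (fun t => dot (stereo_v eps u t) e1)
    (fun t => dot (stereo_v eps u t) e2) (fun t => dot (stereo_v eps u t) e3)
    v _ _ _ (fun s => is_derive_stereo_v eps e1 u s)
    (fun s => is_derive_stereo_v eps e2 u s) (fun s => is_derive_stereo_v eps e3 u s)
    (is_derive_stereo_vv eps e1 u v) (is_derive_stereo_vv eps e2 u v)
    (is_derive_stereo_vv eps e3 u v)).
  assert (L1 := stereo_laplacian_coord eps e1 u v).
  assert (L2 := stereo_laplacian_coord eps e2 u v).
  assert (L3 := stereo_laplacian_coord eps e3 u v).
  assert (G11 := stereo_gradient_coord eps e1 e1 u v Heps).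
  assert (G22 := stereo_gradient_coord eps e2 e2 u v Heps).
  assert (G12 := stereo_gradient_coord eps e1 e2 u v Heps).
  assert (G13 := stereo_gradient_coord eps e1 e3 u v Heps).
  assert (G23 := stereo_gradient_coord eps e2 e3 u v Heps).
  rewrite N1 in G11; rewrite N2 in G22; rewrite N12 in G12; rewrite N13 in G13;
    rewrite N23 in G23.
  rewrite Hlam, !S_INR.
  set (h := conformal_factor u v) in *.
  set (a := dot (stereo eps u v) e1) in *; set (b := dot (stereo eps u v) e2) in *;
  set (c := dot (stereo eps u v) e3) in *;
  set (au := dot (stereo_u eps u v) e1) in *; set (bu := dot (stereo_u eps u v) e2) in *;
  set (cu := dot (stereo_u eps u v) e3) in *;
  set (av := dot (stereo_v eps u v) e1) in *; set (bv := dot (stereo_v eps u v) e2) in *;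
  set (cv := dot (stereo_v eps u v) e3) in *;
  set (auu := dot (stereo_uu eps u v) e1) in *; set (buu := dot (stereo_uu eps u v) e2) in *;
  set (cuu := dot (stereo_uu eps u v) e3) in *;
  set (avv := dot (stereo_vv eps u v) e1) in *; set (bvv := dot (stereo_vv eps u v) e2) in *;
  set (cvv := dot (stereo_vv eps u v) e3) in *.
  rewrite !re_pow_S, !im_pow_S.
  set (p := re_pow k a b); set (q := im_pow k a b); set (n := INR k).
  clearbody h a b c au bu cu av bv cv auu buu cuu avv bvv cvv p q n.
  apply (Rmult_eq_reg_l h); [|lra].
  (* Group the sum of the two second derivatives so that only the Laplacians and
     gradient products of [a], [b], [c] occur. *)
  match goal with |- ?L = _ => transitivity (
   - ((cuu + cvv) * (a * (a * p - b * q) - b * (a * q + b * p))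
     + 2 * (n + 2) * ((a * p - b * q) * (au * cu + av * cv)
                      - (a * q + b * p) * (bu * cu + bv * cv))
     + c * (n + 2) * ((n + 1) * (p * ((au * au + av * av) - (bu * bu + bv * bv))
                                 - 2 * q * (au * bu + av * bv))
        + (a * p - b * q) * (auu + avv) - (a * q + b * p) * (buu + bvv)))
     - h * ((n + 3) * (n + 4) * (c * (a * (a * p - b * q) - b * (a * q + b * p)))));
    [field; lra|] end.
  rewrite L1, L2, L3, G11, G22, G12, G13, G23; ring.
Qed.

(** * Orthonormal frames and polar coordinates *)

Lemma dot_plus_l p q r : dot (plus p q) r = dot p r + dot q r.
Proof.
  destruct p as [[? ?] ?], q as [[? ?] ?], r as [[? ?] ?].
  unfold dot, plus; simpl; unfold plus; simpl; ring.
Qed.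

Lemma dot_scal_l (a : R) p q : dot (scal a p) q = a * dot p q.
Proof.
  destruct p as [[? ?] ?], q as [[? ?] ?].
  unfold dot, scal; simpl; unfold scal; simpl; unfold mult; simpl; ring.
Qed.

Lemma dot_comm p q : dot p q = dot q p.
Proof. destruct p as [[? ?] ?], q as [[? ?] ?]; unfold dot; ring. Qed.

Lemma dot_plus_r p q r : dot r (plus p q) = dot r p + dot r q.
Proof. now rewrite !(dot_comm r), dot_plus_l. Qed.

Lemma dot_scal_r (a : R) p q : dot q (scal a p) = a * dot q p.
Proof. now rewrite !(dot_comm q), dot_scal_l. Qed.

Lemma dot_circle (e1 e2 e3 : R3) (He : orthonormal e1 e2 e3) s :
  dot (circle_param e1 e2 s) e1 = cos s /\
  dot (circle_param e1 e2 s) e2 = sin s /\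
  dot (circle_param e1 e2 s) e3 = 0.
Proof.
  destruct He as (N1 & N2 & N3 & N12 & N13 & N23); unfold circle_param.
  rewrite !dot_plus_l, !dot_scal_l, (dot_comm e2 e1), N1, N2, N12, N13, N23.
  repeat split; ring.
Qed.

Lemma dot_polar (e1 e2 e3 : R3) (He : orthonormal e1 e2 e3) theta s :
  dot (polar_param e1 e2 e3 theta s) e1 = sin theta * cos s /\
  dot (polar_param e1 e2 e3 theta s) e2 = sin theta * sin s /\
  dot (polar_param e1 e2 e3 theta s) e3 = cos theta.
Proof.
  destruct (dot_circle e1 e2 e3 He s) as (C1 & C2 & C3).
  destruct He as (N1 & N2 & N3 & N12 & N13 & N23); unfold polar_param.
  rewrite !dot_plus_l, !dot_scal_l, (dot_comm e3 e1), (dot_comm e3 e2), C1, C2, C3, N3, N13, N23.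
  repeat split; ring.
Qed.

Lemma dX1_polar (e1 e2 e3 : R3) theta s :
  dX1 (polar_param e1 e2 e3) theta s
  = plus (scal (cos theta) (circle_param e1 e2 s)) (scal (- sin theta) e3).
Proof.
  destruct e1 as [[x1 y1] z1], e2 as [[x2 y2] z2], e3 as [[x3 y3] z3].
  unfold dX1, Derive3, polar_param, circle_param.
  repeat (unfold prod_plus, prod_scal, plus, scal, mult; simpl).
  repeat f_equal; apply is_derive_unique; (auto_derive; [trivial|ring]).
Qed.

Lemma dX2_polar (e1 e2 e3 : R3) theta s :
  dX2 (polar_param e1 e2 e3) theta s
  = scal (sin theta) (plus (scal (- sin s) e1) (scal (cos s) e2)).
Proof.
  destruct e1 as [[x1 y1] z1], e2 as [[x2 y2] z2], e3 as [[x3 y3] z3].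
  unfold dX2, Derive3, polar_param, circle_param.
  repeat (unfold prod_plus, prod_scal, plus, scal, mult; simpl).
  repeat f_equal; apply is_derive_unique; (auto_derive; [trivial|ring]).
Qed.

Lemma vol_density_polar (e1 e2 e3 : R3) (He : orthonormal e1 e2 e3) theta s :
  0 < sin theta -> vol_density (polar_param e1 e2 e3) theta s = sin theta.
Proof.
  intros Pos; unfold vol_density.
  assert (G : gdet (polar_param e1 e2 e3) theta s = sin theta ^ 2).
  { unfold gdet, g11, g12, g22; rewrite dX1_polar, dX2_polar.
    destruct He as (N1 & N2 & N3 & N12 & N13 & N23); unfold circle_param.
    rewrite !dot_plus_l, !dot_scal_l, !dot_plus_r, !dot_scal_r, !dot_plus_l, !dot_scal_l,
      !dot_plus_r, !dot_scal_r.
    rewrite (dot_comm e2 e1), (dot_comm e3 e1), (dot_comm e3 e2), N1, N2, N3, N12, N13, N23.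
    assert (T := sin2_cos2 theta); rewrite !Rsqr_pow2 in T.
    assert (S := sin2_cos2 s); rewrite !Rsqr_pow2 in S.
    assert (T' : cos theta ^ 2 = 1 - sin theta ^ 2) by lra.
    assert (S' : cos s ^ 2 = 1 - sin s ^ 2) by lra.
    ring [T' S']. }
  rewrite G; apply sqrt_pow2; lra.
Qed.

(** * Norms of the eigenfunctions *)

Lemma normal_derivative_sphere_harmonic (e1 e2 e3 : R3) (He : orthonormal e1 e2 e3) k s :
  normal_derivative e3 (sphere_harmonic e1 e2 e3 k) (circle_param e1 e2 s)
  = re_pow k (cos s) (sin s).
Proof.
  destruct (dot_circle e1 e2 e3 He s) as (C1 & C2 & C3).
  destruct He as (N1 & N2 & N3 & N12 & N13 & N23).
  unfold normal_derivative.
  rewrite (Derive_ext _ (fun t => sin t * cos t ^ k * re_pow k (cos s) (sin s))).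
  - apply is_derive_unique; auto_derive; [trivial|].
    rewrite sin_0, cos_0, pow1; ring.
  - intros t; unfold sphere_harmonic.
    rewrite !dot_plus_l, !dot_scal_l, (dot_comm e3 e1), (dot_comm e3 e2),
      C1, C2, C3, N3, N13, N23, !Rmult_0_r, !Rplus_0_r, Rplus_0_l, Rmult_1_r.
    rewrite (proj1 (re_im_pow_scale (cos t) k (cos s) (sin s))); ring.
Qed.

Lemma sphere_harmonic_polar (e1 e2 e3 : R3) (He : orthonormal e1 e2 e3) k theta s :
  sphere_harmonic e1 e2 e3 k (polar_param e1 e2 e3 theta s)
  = cos theta * sin theta ^ k * re_pow k (cos s) (sin s).
Proof.
  destruct (dot_polar e1 e2 e3 He theta s) as (C1 & C2 & C3).
  unfold sphere_harmonic; rewrite C1, C2, C3.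
  rewrite (proj1 (re_im_pow_scale (sin theta) k (cos s) (sin s))); ring.
Qed.

Lemma sphere_harmonic_nonzero (e1 e2 e3 : R3) (He : orthonormal e1 e2 e3) k :
  exists p, sphere p /\ sphere_harmonic e1 e2 e3 k p <> 0.
Proof.
  exists (polar_param e1 e2 e3 (PI / 4) 0); split.
  - destruct (dot_polar e1 e2 e3 He (PI / 4) 0) as (C1 & C2 & C3).
    unfold sphere. unfold polar_param at 2. unfold circle_param.
    rewrite !dot_plus_r, !dot_scal_r, !dot_plus_r, !dot_scal_r, C1, C2, C3, cos_0, sin_0.
    assert (T := sin2_cos2 (PI / 4)); unfold Rsqr in T; lra.
  - rewrite (sphere_harmonic_polar e1 e2 e3 He), cos_0, sin_0, re_pow_1_0, Rmult_1_r.
    assert (H := PI_RGT_0).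
    apply Rgt_not_eq, Rmult_lt_0_compat; [apply cos_gt_0; lra|].
    apply pow_lt, sin_gt_0; lra.
Qed.

Lemma L2norm_circle_sphere_harmonic (e1 e2 e3 : R3) (He : orthonormal e1 e2 e3) k (lam : R) :
  L2norm_circle e1 e2
    (fun p => / lam * normal_derivative e3 (sphere_harmonic e1 e2 e3 (S k)) p)
  = sqrt ((/ lam) ^ 2 * PI).
Proof.
  unfold L2norm_circle; f_equal; apply is_RInt_unique.
  apply (is_RInt_ext (fun s => scal ((/ lam) ^ 2) (re_pow (S k) (cos s) (sin s) ^ 2))).
  - intros s _; rewrite (normal_derivative_sphere_harmonic e1 e2 e3 He), Rpow_mult_distr.
    reflexivity.
  - exact (is_RInt_scal _ _ _ ((/ lam) ^ 2) _ (is_RInt_re_pow_circle k)).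
Qed.

Lemma L2norm_sphere_sphere_harmonic (e1 e2 e3 : R3) (He : orthonormal e1 e2 e3) k :
  L2norm_sphere e1 e2 e3 (sphere_harmonic e1 e2 e3 (S k))
  = sqrt (PI * (sin_integral (2 * S k + 1) / (2 * INR (S k) + 3))).
Proof.
  unfold L2norm_sphere; f_equal.
  set (n := (2 * S k + 1)%nat).
  rewrite (RInt_ext _ (fun theta => PI * (sin theta ^ n - sin theta ^ (n + 2)))).
  - apply is_RInt_unique. evar_last.
    { exact (is_RInt_scal _ _ _ PI _
        (is_RInt_minus _ _ _ _ _ _ (is_RInt_sin_pow n) (is_RInt_sin_pow (n + 2)))). }
    assert (E := sin_integral_SS n).
    assert (En : INR n = 2 * INR (S k) + 1)
      by (unfold n; rewrite plus_INR, mult_INR; simpl INR; lra).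
    rewrite !plus_INR, En in E; change (INR 2) with 2 in E; change (INR 1) with 1 in E.
    assert (Hk := pos_INR (S k)).
    change (PI * (sin_integral n - sin_integral (n + 2))
            = PI * (sin_integral n / (2 * INR (S k) + 3))).
    apply f_equal, (Rmult_eq_reg_l (2 * INR (S k) + 3)); [|lra].
    transitivity (sin_integral n); [lra|field; lra].
  - rewrite Rmin_left, Rmax_right by (left; apply PI_RGT_0).
    intros theta Ht; apply is_RInt_unique.
    assert (Pos : 0 < sin theta) by (apply sin_gt_0; apply Ht).
    apply (is_RInt_ext (fun s => scal (sin theta ^ n - sin theta ^ (n + 2))
                                   (re_pow (S k) (cos s) (sin s) ^ 2))).
    + intros s _. rewrite (sphere_harmonic_polar e1 e2 e3 He),
        (vol_density_polar e1 e2 e3 He) by exact Pos.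
      assert (T : cos theta ^ 2 = 1 - sin theta ^ 2)
        by (assert (T := sin2_cos2 theta); rewrite !Rsqr_pow2 in T; lra).
      rewrite !Rpow_mult_distr, T, <- pow_mult; unfold n.
      rewrite !pow_add, (Nat.mul_comm (S k) 2).
      unfold scal; cbn -[pow re_pow Nat.mul]; unfold mult; cbn -[pow re_pow Nat.mul].
      ring.
    + evar_last; [exact (is_RInt_scal _ _ _ (sin theta ^ n - sin theta ^ (n + 2)) _
                           (is_RInt_re_pow_circle k))|].
      apply Rmult_comm.
Qed.

(** * The inequality with the sharp constant *)

Lemma Rle_of_pow_le n x y : 0 <= y -> x ^ S n <= y ^ S n -> x <= y.
Proof.
  intros Hy H; destruct (Rle_lt_dec x y) as [|L]; [assumption|exfalso].
  assert (P : y ^ n <= x ^ n) by (apply pow_incr; lra).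
  assert (Px : 0 < x ^ n) by (apply pow_lt; lra).
  simpl in H; assert (y * y ^ n <= y * x ^ n) by (now apply Rmult_le_compat_l).
  assert (y * x ^ n < x * x ^ n) by (now apply Rmult_lt_compat_r).
  lra.
Qed.

Lemma Rpower_quarter_pow8 x : 0 < x -> Rpower x (1 / 4) ^ 8 = x ^ 2.
Proof.
  intros Hx; rewrite <- Rpower_pow, Rpower_mult by apply exp_pos.
  rewrite <- (Rpower_pow 2) by exact Hx; f_equal; simpl; field.
Qed.

Lemma sqrt_pow8 x : 0 <= x -> sqrt x ^ 8 = x ^ 4.
Proof.
  intros Hx; change 8%nat with (2 * 4)%nat; now rewrite pow_mult, pow2_sqrt.
Qed.

(** Raising to the eighth power clears the fourth roots and the square roots; what
    remains is [sin_integral_odd_lower_bound]. *)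
Lemma trace_inequality k (lam : R) :
  0 < lam -> lam ^ 2 = (INR k + 1) * (INR k + 2) ->
  sqrt ((/ lam) ^ 2 * PI)
  <= trace_constant * Rpower lam (- (1 / 4))
     * sqrt (PI * (sin_integral (2 * k + 1) / (2 * INR k + 3))).
Proof.
  intros Hlam Elam.
  assert (HPI := PI_RGT_0); assert (Hk := pos_INR k).
  assert (I := sin_integral_odd_lower_bound k).
  assert (PI1 := sin_integral_pos (2 * k + 1)).
  rewrite <- Elam in I.
  set (J := sin_integral (2 * k + 1)) in *; set (d := 2 * INR k + 3) in *.
  assert (Hd : 0 < d) by (unfold d; lra).
  assert (H4 : 0 < 4 / PI) by (apply Rdiv_lt_0_compat; lra).
  assert (HJ : 0 < J / d) by (now apply Rdiv_lt_0_compat).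
  apply (Rle_of_pow_le 7).
  { repeat apply Rmult_le_pos; try apply sqrt_pos; left; apply exp_pos. }
  rewrite !Rpow_mult_distr, !sqrt_pow8.
  - unfold trace_constant; rewrite Rpower_Ropp, !pow_inv, !Rpower_quarter_pow8 by assumption.
    (* This factor clears all denominators of the eighth powers. *)
    apply (Rmult_le_reg_r (lam ^ 8 * d ^ 4 / PI ^ 2)).
    { apply Rdiv_lt_0_compat; [apply Rmult_lt_0_compat|]; now apply pow_lt. }
    match goal with |- ?L <= ?U =>
      replace L with (PI ^ 2 * d ^ 4) by (field; lra);
      replace U with (16 * (lam ^ 2) ^ 3 * J ^ 4) by (field; lra) end.
    exact I.
  - apply Rmult_le_pos; lra.
  - apply Rmult_le_pos; [apply pow2_ge_0|lra].
Qed.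

Theorem proposition1p10 :
  forall e1 e2 e3 : R3, orthonormal e1 e2 e3 ->
  exists (lam : nat -> R) (phi : nat -> R3 -> R),
    is_lim_seq lam p_infty /\
    forall j : nat,
      0 < lam j /\
      smooth_on_sphere (phi j) /\
      (exists p, sphere p /\ phi j p <> 0) /\
      helmholtz_on_sphere (lam j) (phi j) /\
      (forall p, great_circle e3 p -> phi j p = 0) /\
      L2norm_circle e1 e2
        (fun p => / lam j * normal_derivative e3 (phi j) p)
      <= trace_constant * Rpower (lam j) (- (1 / 4))
           * L2norm_sphere e1 e2 e3 (phi j).
Proof.
  intros e1 e2 e3 He.
  exists (fun j => sqrt ((INR j + 3) * (INR j + 4))),
         (fun j => sphere_harmonic e1 e2 e3 (S (S j))).
  split.
  - apply (is_lim_seq_le_p_loc INR); [|exact is_lim_seq_INR].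
    exists 0%nat; intros j _; assert (Hj := pos_INR j).
    rewrite <- (sqrt_square (INR j)) at 1 by exact Hj.
    apply sqrt_le_1_alt; nra.
  - intros j; cbv beta; assert (Hj := pos_INR j).
    set (lam := sqrt ((INR j + 3) * (INR j + 4))).
    assert (Hlam : 0 < lam) by (apply sqrt_lt_R0; nra).
    assert (Elam : lam ^ 2 = (INR j + 3) * (INR j + 4)) by (apply pow2_sqrt; nra).
    split; [exact Hlam|].
    split; [apply smooth_sphere_harmonic|].
    split; [now apply sphere_harmonic_nonzero|].
    split; [now apply helmholtz_sphere_harmonic|].
    split.
    + intros p [_ Hp]; unfold sphere_harmonic; rewrite Hp; ring.
    + rewrite L2norm_circle_sphere_harmonic, L2norm_sphere_sphere_harmonic by exact He.
      apply trace_inequality; [exact Hlam|].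
      rewrite Elam, !S_INR; ring.
Qed.
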